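(* Let $p,k\ge1$ be fixed integers. If $n>p(k+1)$, then for $\alpha_n$ chosen uniformly at random from $\mathcal C_n$, with $P_n=P(\alpha_n)$ and $K_n=K(\alpha_n)$, $$\mathbb P(P_n=p,K_n=k)=2^{-pk}(1-2^{-p}).$$
   Context: $\mathcal C_n$ is the set of integer compositions of $n$, i.e. ordered sequences $\alpha=(a_1,\ldots,a_\ell)$ of integers $a_i\ge1$ with sum $n$. The initial run of $\alpha$ is the maximal prefix $(a_1,\ldots,a_k)$ whose entries are all equal; $P(\alpha)=a_1$ and $K(\alpha)=k$ is the number of parts in it. *)

(* Defs.v *)
From HB Require Import structures.
From mathcomp Require Import all_boot all_order all_algebra.

Set Implicit Arguments.
Unset Strict Implicit.
Unset Printing Implicit Defensive.

Import Order.TTheory GRing.Theory Num.Theory.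

Record composition (n : nat) := Composition {
  parts :> seq nat;
  partsP : all (leq 1) parts && (sumn parts == n)
}.

HB.instance Definition _ n := [isSub for @parts n].
HB.instance Definition _ n := [Countable of composition n by <:].

(* Finiteness: a composition of n has at most n parts, each at most n. *)
Section CompositionFinite.
Variable n : nat.

Fact size_parts (a : composition n) : size a <= n.
Proof.
case: a => s /= /andP[+ /eqP<-]; elim: s => //= x s IHs /andP[x_gt0 /IHs].
exact: (@leq_add 1).
Qed.

Fact parts_le (a : composition n) : {in parts a, forall x, x < n.+1}.
Proof.
case: a => s /= /andP[_ /eqP<-] x; elim: s => //= y s IHs.
rewrite inE => /predU1P[->|/IHs]; first by rewrite ltnS leq_addr.
by rewrite !ltnS => /leq_trans-> //; rewrite leq_addl.
Qed.

Definition composition_to_bseq (a : composition n) : n.-bseq 'I_n.+1 :=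
  insub_bseq n [seq inord x | x <- parts a].

Definition composition_of_bseq (b : n.-bseq 'I_n.+1) : option (composition n) :=
  insub [seq val i | i <- b].

Fact composition_to_bseqK : pcancel composition_to_bseq composition_of_bseq.
Proof.
move=> a; rewrite /composition_of_bseq /composition_to_bseq /insub_bseq.
rewrite val_insubd size_map size_parts -map_comp map_id_in ?valK //.
by move=> x /parts_le; exact: inordK.
Qed.

HB.instance Definition _ :=
  isFinite.Build (composition n) (pcan_enumP composition_to_bseqK).

End CompositionFinite.

(* The prefixes of s are the [take j s] with j <= size s; the initial run is   *)
(* the longest of them whose entries are all equal.                            *)
Definition initial_run (s : seq nat) : seq nat :=
  take (\max_(j < (size s).+1 | constant (take j s)) j) s.

(* The default value 0 is returned only on the empty composition (of 0). *)
Definition run_part (n : nat) (a : composition n) : nat := head 0 a.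

Definition run_length (n : nat) (a : composition n) : nat :=
  size (initial_run a).

Definition uniform_prob (R : realFieldType) (T : finType) (E : {set T}) : R :=
  (#|E|%:R / #|T|%:R)%R.

(* Main.v *)
Require Import Defs.
From mathcomp Require Import all_boot all_order all_algebra.
From mathcomp Require Import ring.

(** Prescribing the initial run means prescribing a prefix and forbidding
    another: for [k > 0], the initial run of [a] consists of exactly [k] copies of [p] iff
    [a] begins with [k] copies of [p] but not with [k.+1] of them
    ([run_part_lengthE]).  Deleting a prefix of [j] copies of [p] is a bijection
    onto the compositions of [n - p * j] ([card_prefix_nseq]), and a positive
    integer [m] has [2 ^ (m - 1)] compositions ([card_composition]).  Both
    [n - p * k] and [n - p * k.+1] are positive because [p * (k + 1) < n], so the
    event has [2 ^ (n - p * k - 1) - 2 ^ (n - p * k.+1 - 1)] elements; dividing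
    by [2 ^ (n - 1)] gives the formula. *)

Import Order.TTheory GRing.Theory Num.Theory.
Local Open Scope ring_scope.

Lemma prefix_nseq_leq (p i j : nat) (s : seq nat) :
  (i <= j)%N -> prefix (nseq j p) s -> prefix (nseq i p) s.
Proof.
move=> le_ij; apply: prefix_trans.
by rewrite -(subnKC le_ij) nseqD prefix_prefix.
Qed.

Lemma constant_take_prefix (j : nat) (s : seq nat) : (j <= size s)%N ->
  constant (take j s) = prefix (nseq j (head 0%N s)) s.
Proof.
case: s j => [|x s] [|j] //= le_js; rewrite eqxx /= prefixE size_nseq.
by rewrite -{3}(size_takel le_js); apply/all_pred1P/eqP.
Qed.

(** If [s] begins with [j] copies of its first part then it begins with [i] of
    them for every [i <= j], so the lengths whose prefix is constant are exactly
    those up to the maximum in the definition of the initial run. *)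
Lemma leq_size_initial_run (j : nat) (s : seq nat) :
  (j <= size (initial_run s))%N = prefix (nseq j (head 0%N s)) s.
Proof.
rewrite /initial_run; set M := (\max_(i < _ | _) _)%N.
have le_Ms : (M <= size s)%N by apply/bigmax_leqP => i _; rewrite -ltnS.
rewrite size_takel //; apply/idP/idP => [le_jM | pre_j].
  apply: (prefix_nseq_leq _ _ _ _ le_jM); rewrite -constant_take_prefix //.
  have [|i const_i def_M] := @eq_bigmax_cond _
    [pred i : 'I_(size s).+1 | constant (take i s)] (@nat_of_ord _).
    by apply/card_gt0P; exists ord0; rewrite inE /= take0.
  by rewrite (def_M : M = i).
have le_js : (j <= size s)%N by have := size_prefix pre_j; rewrite size_nseq.
have lt_js : (j < (size s).+1)%N by [].
apply: (@leq_bigmax_cond _ _ (@nat_of_ord _) (Ordinal lt_js)).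
by rewrite /= constant_take_prefix.
Qed.

(** When the first part is [p], the two prefix conditions say that the run length
    is at least [k] and less than [k.+1].  When it is not, no nonempty block of
    copies of [p] is a prefix; this is where [0 < k] enters. *)
Lemma run_part_lengthE (n p k : nat) (a : composition n) : (0 < k)%N ->
  (run_part a == p) && (run_length a == k)
    = prefix (nseq k p) a && ~~ prefix (nseq k.+1 p) a.
Proof.
move=> k_gt0; rewrite /run_part /run_length.
have [<-|neq_p] := eqVneq (head 0%N a) p.
  by rewrite andTb -!leq_size_initial_run -leqNgt eqn_leq andbC.
case: k k_gt0 => // k _; case: (parts a) neq_p => //= x s.
by rewrite eq_sym => /negPf ->.
Qed.

Lemma composition_cat_subproof (p j m : nat) (b : composition m) : (0 < p)%N ->
  let s := nseq j p ++ b in all (leq 1) s && (sumn s == p * j + m)%N.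
Proof.
move=> p_gt0; case: b => s /= /andP[pos_s /eqP sum_s].
by rewrite all_cat all_nseq p_gt0 orbT pos_s sumn_cat sumn_nseq sum_s eqxx.
Qed.

(** Prepending [j] copies of [p] is injective, and its image is the set of
    compositions that begin with them. *)
Lemma card_prefix_nseq (p j m : nat) : (0 < p)%N ->
  #|[set a : composition (p * j + m) | prefix (nseq j p) a]|
    = #|{: composition m}|.
Proof.
move=> p_gt0.
pose f (b : composition m) := Composition (composition_cat_subproof p j m b p_gt0).
have f_inj : injective f.
  move=> b c /(congr1 val) /= /eqP; rewrite eqseq_cat // eqxx /= => /eqP bc.
  exact: val_inj.
rewrite -cardsT -(card_imset _ f_inj); apply: eq_card => a; rewrite inE.
apply/idP/imsetP => [/prefixP[s def_a] | [b _ ->]]; last exact: prefix_prefix.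
have := partsP a; rewrite def_a all_cat sumn_cat sumn_nseq eqn_add2l.
case/andP=> /andP[_ pos_s] sum_s.
have s_ok : all (leq 1) s && (sumn s == m) by rewrite pos_s.
by exists (Composition s_ok); rewrite ?inE //; apply: val_inj.
Qed.

Definition incr_head (s : seq nat) : seq nat :=
  if s is x :: s' then x.+1 :: s' else [::].

Lemma incr_head_subproof (m : nat) (a : composition m.+1) :
  all (leq 1) (incr_head a) && (sumn (incr_head a) == m.+2).
Proof.
by case: a => [[|x s] //= /andP[/andP[_ ->] /eqP <-]]; rewrite addSn eqxx.
Qed.

(** The compositions of [m.+2] with first part [1] correspond to those of
    [m.+1] by deleting this part; the others correspond to them by decrementing
    the first part, so the count doubles. *)
Lemma card_composition (m : nat) : #|{: composition m.+1}| = (2 ^ m)%N.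
Proof.
elim: m => [|m IHm].
  have one_ok : all (leq 1) [:: 1%N] && (sumn [:: 1%N] == 1%N) by [].
  apply/eqP/fintype1P; exists (Composition one_ok) => -[s s_ok].
  apply: val_inj => /=.
  by case: s s_ok => [|[|[|x]] [|[|y] s]] //=; rewrite !(addSn, addnS) andbF.
pose A := [set a : composition m.+2 | prefix (nseq 1 1%N) a].
have cardA : #|A| = (2 ^ m)%N by rewrite -IHm -(card_prefix_nseq 1 1 m.+1).
pose f (a : composition m.+1) := Composition (incr_head_subproof m a).
have f_inj : injective f.
  move=> [s s_ok] [t t_ok] /(congr1 val) /= st; apply: val_inj => /=.
  by case: s t {s_ok t_ok} st => [|x s] [|y t] //= [-> ->].
have cardAC : #|~: A| = (2 ^ m)%N.
  rewrite -IHm -[in RHS]cardsT -(card_imset _ f_inj); apply: eq_card => a.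
  rewrite !inE; apply/idP/imsetP => [|[[[|[|x] s] s_ok] _ ->]] //.
  case: a => -[|[|[|x]] s] s_ok //=; first by rewrite prefix0s.
  move=> _.
  have t_ok : all (leq 1) (x.+1 :: s) && (sumn (x.+1 :: s) == m.+1) by [].
  by exists (Composition t_ok); rewrite ?inE //; apply: val_inj.
by rewrite -(cardsC A) cardA cardAC addnn -mul2n expnS.
Qed.

Theorem corollary4p2 (R : realFieldType) (p k n : nat)
    (hp : (1 <= p)%N) (hk : (1 <= k)%N) (hn : (p * (k + 1) < n)%N) :
  uniform_prob R [set a : composition n | (run_part a == p) && (run_length a == k)]
    = 2 ^- (p * k) * (1 - 2 ^- p).
Proof.
have [m def_n] : exists m, n = (p * k.+1 + m.+1)%N.
  by exists (n - (p * k.+1).+1)%N; rewrite addnS -addSn subnKC // -[k.+1]addn1.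
pose A j := [set a : composition n | prefix (nseq j p) a].
have -> : [set a : composition n | (run_part a == p) && (run_length a == k)]
          = A k :\: A k.+1.
  by apply/setP => a; rewrite !inE run_part_lengthE // andbC.
have sub_A : A k.+1 \subset A k.
  by apply/subsetP => a; rewrite !inE; exact: prefix_nseq_leq.
have cardA : #|A k.+1| = (2 ^ m)%N.
  by rewrite /A def_n card_prefix_nseq // card_composition.
have def_n' : n = (p * k + (p + m).+1)%N.
  by rewrite def_n mulnS [(p + _)%N]addnC -addnA addnS.
have cardAk : #|A k| = (2 ^ (p + m))%N.
  by rewrite /A def_n' card_prefix_nseq // card_composition.
have cardT : #|{: composition n}| = (2 ^ (p * k + (p + m)))%N.
  by rewrite def_n' addnS card_composition.
have nz i : 2 ^+ i != 0 :> R by rewrite expf_neq0 // pnatr_eq0.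
rewrite /uniform_prob cardsD (setIidPr sub_A) cardA cardAk cardT.
rewrite natrB ?leq_exp2l ?leq_addl // !natrX !exprD.
by field; rewrite !nz.
Qed.
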